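(* Let $f:\mathbb{R}\to\mathbb{R}$ be a function whose derivative is $$f'(x)=\begin{cases}\dfrac{x}{10}-24.9 & \text{if } x<-1,\\[1ex] 25x & \text{if } -1\le x<1,\\[1ex] \dfrac{x}{10}+24.9 & \text{if } x\ge 1,\end{cases}$$ so that $f'$ is Lipschitz with constant $L=25$. Suppose that the AA-GD method is applied to minimize $f$ with history parameter $m=1$ and step size $\gamma=1/L=1/25$. Then, for any initial point $x_0\in[2.01,\,246.98]$, the iterates generated by AA-GD satisfy, for all $n=0,1,2,\dots$, $$x_{4n+4}=249,\qquad x_{4n+6}=-249,$$ and, as $n\to\infty$, $$x_{4n+3}\to-249(\sqrt5-2),\qquad x_{4n+5}\to 249(\sqrt5-2).$$
   Context: AA-GD (Anderson accelerated gradient descent) with history parameter $m=1$ and step size $\gamma$ is Anderson acceleration applied to the map $g(x)=x-\gamma f'(x)$: start from $x_0$, set $x_1=g(x_0)$, and for $k=1,2,\dots$ let $r_i=g(x_i)-x_i=-\gamma f'(x_i)$, choose $$(\alpha_0^k,\alpha_1^k)\in\operatorname{argmin}_{\alpha_0+\alpha_1=1}|\alpha_0 r_k+\alpha_1 r_{k-1}|,$$ and set $x_{k+1}=\alpha_0^k g(x_k)+\alpha_1^k g(x_{k-1})$. *)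

(* Defs.v *)
(* Standard-library reals with Coquelicot. *)
From Stdlib Require Import Reals.
From Coquelicot Require Import Coquelicot.
Open Scope R_scope.

Definition lipschitz (L : R) (h : R -> R) : Prop :=
  forall x y : R, Rabs (h x - h y) <= L * Rabs (x - y).

Definition is_argmin {T : Type} (D : T -> Prop) (F : T -> R) (a : T) : Prop :=
  D a /\ forall b : T, D b -> F a <= F b.

(* Any minimizer of the least-squares step may be chosen, so this is a relation
   on sequences rather than a function of the initial point. *)
Definition anderson1 (g : R -> R) (x : nat -> R) : Prop :=
  let r (i : nat) := g (x i) - x i in
  x 1%nat = g (x 0%nat) /\
  forall k : nat, (1 <= k)%nat ->
    exists alpha : R * R,
      is_argmin (fun a : R * R => fst a + snd a = 1)
                (fun a : R * R => Rabs (fst a * r k + snd a * r (k - 1)%nat))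
                alpha /\
      x (k + 1)%nat = fst alpha * g (x k) + snd alpha * g (x (k - 1)%nat).

Definition AA_GD1 (f : R -> R) (gamma : R) (x : nat -> R) : Prop :=
  anderson1 (fun t : R => t - gamma * Derive f t) x.

Definition fprime (x : R) : R :=
  if Rlt_dec x (-1) then x / 10 - 24.9
  else if Rlt_dec x 1 then 25 * x
  else x / 10 + 24.9.

(* Main.v *)
Require Import Defs.
From Stdlib Require Import Reals Lra Lia.
From Coquelicot Require Import Coquelicot.
Open Scope R_scope.

(** In one dimension the least-squares problem with history length one can be
    solved exactly: as soon as two consecutive residuals differ, the optimal
    combination has zero residual, so the iteration is the secant method for
    the equation [f' = 0].

    For the present [f'] the secant through two points of the right affine
    branch meets the axis at [-249], and the secant through two points of the
    left branch meets it at [249].  The initial interval is chosen so that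
    [x 0] and [x 1] both lie on the right branch, whence [x 2 = -249].  From
    then on the method repeats one pattern, up to a global change of sign
    allowed by the oddness of [f'] ([two_secant_steps]): if the last two
    iterates are [y] in [[1, 245]] and [-249], the next two are
    [- psi y] and [249], where [psi y = 249 (249 - y) / (y + 747)].  Indeed the
    secant across the two branches lands at [- psi y], and [psi] maps
    [[1, 245]] into itself, so that [-249] and [- psi y] are again on one common
    branch.

    Hence the iterates of even index alternate between [-249] and [249], and
    those of odd index are, up to alternating signs, the orbit of [x 1] under
    the Moebius map [psi].  On the positive half-line [psi] has the single fixed
    point [249 (sqrt 5 - 2)] and shrinks distances to it by the factor [4/9],
    which gives the limits. *)

(** * The secant method behind Anderson acceleration *)

(** The zero [c] of the secant of [h] through [a] and [b], in a form without
    division.  The premise excludes horizontal secants, for which the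
    least-squares step leaves the coefficients undetermined. *)
Definition secant_step (h : R -> R) (a b c : R) : Prop :=
  h a <> h b -> c * (h b - h a) = a * h b - b * h a.

(** The affine combinations of two different numbers cover the whole line, so
    the minimum of the absolute value is attained only at zero. *)
Lemma argmin_affine_comb_eq0 (p q : R) (a : R * R) :
  p <> q ->
  is_argmin (fun a => fst a + snd a = 1)
            (fun a => Rabs (fst a * p + snd a * q)) a ->
  fst a * p + snd a * q = 0.
Proof.
intros Hpq [_ Hmin].
assert (Hd : p - q <> 0) by lra.
assert (H0 := Hmin (- q / (p - q), p / (p - q))); simpl in H0.
replace (- q / (p - q) * p + p / (p - q) * q) with 0 in H0 by (field; lra).
rewrite Rabs_R0 in H0.
assert (H1 : - q / (p - q) + p / (p - q) = 1) by (field; lra).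
specialize (H0 H1).
destruct (Req_dec (fst a * p + snd a * q) 0) as [|Hne]; [assumption|].
apply Rabs_pos_lt in Hne; lra.
Qed.

(** A combination with zero residual mixes the points [g (x i)] as it mixes the
    [x i] themselves; eliminating its coefficients leaves the secant formula. *)
Lemma AA_GD1_secant (f h : R -> R) (gamma : R) (x : nat -> R) (k : nat) :
  (forall t, Derive f t = h t) -> gamma <> 0 -> AA_GD1 f gamma x ->
  secant_step h (x k) (x (S k)) (x (S (S k))).
Proof.
intros Hh Hg [_ Hx] Hne.
destruct (Hx (S k)) as [[a b] [Hmin Hnext]]; [lia|].
replace (S k + 1)%nat with (S (S k)) in Hnext by lia.
replace (S k - 1)%nat with k in Hmin, Hnext by lia.
assert (Hsum := proj1 Hmin); simpl in Hsum.
apply argmin_affine_comb_eq0 in Hmin; simpl in Hmin, Hnext.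
- rewrite !Hh in Hmin, Hnext.
  assert (Hz : a * h (x (S k)) + b * h (x k) = 0).
  { apply (Rmult_eq_reg_l gamma); [|assumption]. lra. }
  rewrite Hnext.
  replace (a * (x (S k) - gamma * h (x (S k))) + b * (x k - gamma * h (x k)))
    with (a * x (S k) + b * x k - gamma * (a * h (x (S k)) + b * h (x k)))
    by ring.
  rewrite Hz.
  replace a with (1 - b) in Hz |- * by lra.
  (* With [a = 1 - b] the claim is a multiple of the zero-residual relation. *)
  enough ((x k - x (S k)) * ((1 - b) * h (x (S k)) + b * h (x k)) = 0) by lra.
  rewrite Hz; ring.
- rewrite !Hh; intros H; apply Hne.
  apply (Rmult_eq_reg_l gamma); [lra | assumption].
Qed.

Lemma secant_step_sign (h : R -> R) (s a b c : R) :
  (forall t, h (- t) = - h t) -> s = 1 \/ s = -1 ->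
  secant_step h a b c -> secant_step h (s * a) (s * b) (s * c).
Proof.
unfold secant_step; intros Hodd [-> | ->] H.
- rewrite !Rmult_1_l; exact H.
- replace (-1 * a) with (- a) by ring; replace (-1 * b) with (- b) by ring.
  rewrite !Hodd; intros Hne.
  assert (H' := H ltac:(lra)); lra.
Qed.

(** * The piecewise affine derivative *)

Lemma fprime_right (t : R) : 1 <= t -> fprime t = t / 10 + 24.9.
Proof.
intros H; unfold fprime.
destruct (Rlt_dec t (-1)), (Rlt_dec t 1); lra.
Qed.

Lemma fprime_odd (t : R) : fprime (- t) = - fprime t.
Proof.
unfold fprime.
(* The branches agree at the breakpoints, so that their asymmetric
   assignment to the pieces is harmless. *)
destruct (Rlt_dec t (-1)), (Rlt_dec t 1), (Rlt_dec (- t) (-1)),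
  (Rlt_dec (- t) 1); lra.
Qed.

Lemma fprime_left (t : R) : t <= -1 -> fprime t = t / 10 - 24.9.
Proof.
intros H.
replace t with (- - t) at 1 by ring.
rewrite fprime_odd, fprime_right; lra.
Qed.

Lemma fprime_slope (a b : R) :
  a < b -> 0 < fprime b - fprime a <= 25 * (b - a).
Proof.
intros H; unfold fprime.
destruct (Rlt_dec a (-1)), (Rlt_dec a 1), (Rlt_dec b (-1)), (Rlt_dec b 1);
  lra.
Qed.

Lemma lipschitz_fprime : lipschitz 25 fprime.
Proof.
intros a b.
destruct (Rtotal_order a b) as [H | [-> | H]].
- assert (H' := fprime_slope _ _ H).
  rewrite !Rabs_left by lra; lra.
- rewrite !Rminus_diag, Rabs_R0; lra.
- assert (H' := fprime_slope _ _ H).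
  rewrite !Rabs_right by lra; lra.
Qed.

Lemma secant_right (a b c : R) :
  1 <= a -> 1 <= b -> a <> b -> secant_step fprime a b c -> c = -249.
Proof.
intros Ha Hb Hab H; unfold secant_step in H.
rewrite !fprime_right in H by assumption.
assert (H' := H ltac:(lra)).
apply (Rmult_eq_reg_r (b - a)); lra.
Qed.

Lemma secant_left (a b c : R) :
  a <= -1 -> b <= -1 -> a <> b -> secant_step fprime a b c -> c = 249.
Proof.
intros Ha Hb Hab H; unfold secant_step in H.
rewrite !fprime_left in H by assumption.
assert (H' := H ltac:(lra)).
apply (Rmult_eq_reg_r (b - a)); lra.
Qed.

(** * The map governing the odd iterates *)

Definition psi (y : R) : R := 249 * (249 - y) / (y + 747).

(** Since [psi] is decreasing, only the endpoints matter; the value at [245]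
    barely exceeds [1], which is what limits the admissible initial interval
    from above. *)
Lemma psi_bounds (y : R) : 1 <= y <= 245 -> 1 <= psi y <= 245.
Proof.
intros H; unfold psi; split.
- apply Rle_div_r; lra.
- apply Rle_div_l; lra.
Qed.

Lemma secant_across (a c : R) :
  1 <= a -> secant_step fprime a (-249) c -> c = - psi a.
Proof.
intros Ha H; unfold secant_step in H.
rewrite (fprime_right a), (fprime_left (-249)) in H by lra.
assert (H' := H ltac:(lra)).
apply (Rmult_eq_reg_r (a + 747)); [|lra].
unfold psi; field_simplify; lra.
Qed.

(** Half of the period-four pattern: the pair [(a, -249)] is replaced by
    [(- psi a, 249)], which is a pair of the same kind up to sign. *)
Lemma two_secant_steps (a c d : R) :
  1 <= a <= 245 ->
  secant_step fprime a (-249) c -> secant_step fprime (-249) c d ->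
  c = - psi a /\ d = 249.
Proof.
intros Ha Hc Hd.
apply secant_across in Hc; [|lra].
assert (Hp := psi_bounds a Ha).
split; [exact Hc|].
apply (secant_left (-249) c); lra || assumption.
Qed.

Lemma psi_fixpoint_pos : 0 < 249 * (sqrt 5 - 2).
Proof.
assert (2 < sqrt 5); [|lra].
rewrite <- (sqrt_Rsqr 2) by lra.
apply sqrt_lt_1; unfold Rsqr; lra.
Qed.

Lemma psi_fixpoint : psi (249 * (sqrt 5 - 2)) = 249 * (sqrt 5 - 2).
Proof.
assert (H := psi_fixpoint_pos).
assert (H5 : sqrt 5 * sqrt 5 = 5) by (apply sqrt_sqrt; lra).
apply (Rmult_eq_reg_r (249 * (sqrt 5 - 2) + 747)); [|lra].
unfold psi, Rdiv; rewrite Rmult_assoc, Rinv_l by lra.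
lra.
Qed.

(** The factor is [249 * 996 / 747 ^ 2 = 4 / 9], from the Moebius identity for
    the difference of two values. *)
Lemma psi_contraction (y z : R) :
  0 <= y -> 0 <= z -> Rabs (psi y - psi z) <= 4 / 9 * Rabs (y - z).
Proof.
intros Hy Hz.
replace (psi y - psi z)
  with (- (249 * 996 / ((y + 747) * (z + 747))) * (y - z))
  by (unfold psi; field; lra).
rewrite Rabs_mult, Rabs_Ropp.
apply Rmult_le_compat_r; [apply Rabs_pos|].
assert (Hyz : 0 <= y * z) by (apply Rmult_le_pos; assumption).
assert (Hpos : 0 < (y + 747) * (z + 747)) by lra.
rewrite Rabs_right.
- apply Rle_div_l; lra.
- apply Rle_ge, Rlt_le, Rdiv_lt_0_compat; lra.
Qed.

Lemma is_lim_seq_contraction (u : nat -> R) (l q : R) :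
  0 <= q < 1 ->
  (forall n, Rabs (u (S n) - l) <= q * Rabs (u n - l)) -> is_lim_seq u l.
Proof.
intros Hq Hu.
assert (Hgeom : forall n, Rabs (u n - l) <= q ^ n * Rabs (u 0%nat - l)).
{ induction n as [|n IH]; simpl; [lra|].
  apply Rle_trans with (1 := Hu n).
  rewrite Rmult_assoc; apply Rmult_le_compat_l; [lra | exact IH]. }
apply is_lim_seq_ext with (fun n => (u n - l) + l); [intros n; ring|].
replace (Finite l) with (Finite (0 + l)) by (f_equal; ring).
apply is_lim_seq_plus'; [|apply is_lim_seq_const].
apply is_lim_seq_abs_0.
apply is_lim_seq_le_le with (2 := is_lim_seq_const 0)
  (w := fun n => q ^ n * Rabs (u 0%nat - l)).
- intros n; split; [apply Rabs_pos | apply Hgeom].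
- replace (Finite 0) with (Rbar_mult 0 (Rabs (u 0%nat - l)))
    by (simpl; f_equal; ring).
  apply is_lim_seq_scal_r, is_lim_seq_geom.
  rewrite Rabs_right; lra.
Qed.

(** * The orbit *)

Lemma pow_m1_cases (m : nat) : (-1) ^ m = 1 \/ (-1) ^ m = -1.
Proof. induction m as [|m [IH | IH]]; simpl; rewrite ?IH; lra. Qed.

(** Multiplying by [(-1) ^ m] brings every half period to the single case of
    [two_secant_steps]. *)
Lemma secant_orbit (x : nat -> R) :
  (forall k, secant_step fprime (x k) (x (S k)) (x (S (S k)))) ->
  1 <= x 1%nat <= 245 -> x 2%nat = -249 ->
  forall m : nat,
    (-1) ^ m * x (2 * m + 2)%nat = -249 /\
    1 <= (-1) ^ m * x (2 * m + 1)%nat <= 245 /\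
    (-1) ^ S m * x (2 * S m + 1)%nat = psi ((-1) ^ m * x (2 * m + 1)%nat).
Proof.
intros Hx H1 H2.
assert (Hnext : forall m,
  (-1) ^ m * x (2 * m + 2)%nat = -249 ->
  1 <= (-1) ^ m * x (2 * m + 1)%nat <= 245 ->
  (-1) ^ S m * x (2 * S m + 1)%nat = psi ((-1) ^ m * x (2 * m + 1)%nat) /\
  (-1) ^ S m * x (2 * S m + 2)%nat = -249).
{ intros m He Ho.
  pose proof (fun k => secant_step_sign fprime _ _ _ _ fprime_odd
    (pow_m1_cases m) (Hx k)) as Hs.
  pose proof (Hs (2 * m + 1)%nat) as Hc.
  pose proof (Hs (2 * m + 2)%nat) as Hd.
  replace (S (2 * m + 1)) with (2 * m + 2)%nat in Hc by lia.
  replace (S (2 * m + 2)) with (2 * S m + 1)%nat in Hc, Hd by lia.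
  replace (S (2 * S m + 1)) with (2 * S m + 2)%nat in Hd by lia.
  rewrite He in Hc, Hd.
  destruct (two_secant_steps _ _ _ Ho Hc Hd) as [Hc' Hd'].
  rewrite <- tech_pow_Rmult; lra. }
induction m as [|m [He [Ho Hpsi]]].
- assert (He : (-1) ^ 0 * x (2 * 0 + 2)%nat = -249) by (simpl; lra).
  assert (Ho : 1 <= (-1) ^ 0 * x (2 * 0 + 1)%nat <= 245) by (simpl; lra).
  split; [exact He | split; [exact Ho | exact (proj1 (Hnext _ He Ho))]].
- assert (He' := proj2 (Hnext _ He Ho)).
  assert (Ho' : 1 <= (-1) ^ S m * x (2 * S m + 1)%nat <= 245)
    by (rewrite Hpsi; apply psi_bounds; exact Ho).
  split; [exact He' | split; [exact Ho' | exact (proj1 (Hnext _ He' Ho'))]].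
Qed.

Lemma pow_m1_even (n : nat) : (-1) ^ (2 * n + 2) = 1.
Proof.
replace (2 * n + 2)%nat with (2 * (n + 1))%nat by lia; apply pow_1_even.
Qed.

Lemma pow_m1_odd (n : nat) : (-1) ^ (2 * n + 1) = -1.
Proof.
replace (2 * n + 1)%nat with (S (2 * n)) by lia; apply pow_1_odd.
Qed.

Theorem proposition1 :
  forall f : R -> R,
    (forall t : R, is_derive f t (fprime t)) ->
    lipschitz 25 (Derive f) /\
    forall x : nat -> R,
      AA_GD1 f (1 / 25) x ->
      2.01 <= x 0%nat <= 246.98 ->
      (forall n : nat, x (4 * n + 4)%nat = 249 /\ x (4 * n + 6)%nat = -249) /\
      is_lim_seq (fun n : nat => x (4 * n + 3)%nat) (Finite (- 249 * (sqrt 5 - 2))) /\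
      is_lim_seq (fun n : nat => x (4 * n + 5)%nat) (Finite (249 * (sqrt 5 - 2))).
Proof.
intros f Hf.
assert (HD : forall t, Derive f t = fprime t)
  by (intros t; apply is_derive_unique, Hf).
split.
{ intros a b; rewrite !HD; apply lipschitz_fprime. }
intros x HA H0.
assert (Hx : forall k, secant_step fprime (x k) (x (S k)) (x (S (S k)))).
{ intros k; apply (AA_GD1_secant f fprime (1 / 25)); [exact HD | lra | exact HA]. }
assert (Hx1 : x 1%nat = 0.996 * (x 0%nat - 1)).
{ rewrite (proj1 HA), HD, fprime_right by lra; lra. }
assert (Hx2 : x 2%nat = -249).
{ apply (secant_right (x 0%nat) (x 1%nat)); [lra | lra | lra | apply Hx]. }
assert (Horb := secant_orbit x Hx ltac:(lra) Hx2).
assert (Hlim : is_lim_seq (fun m => (-1) ^ m * x (2 * m + 1)%nat)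
                          (249 * (sqrt 5 - 2))).
{ apply is_lim_seq_contraction with (4 / 9); [lra|].
  intros m; destruct (Horb m) as [_ [Ho ->]].
  rewrite <- psi_fixpoint at 1.
  apply psi_contraction; [lra | apply Rlt_le, psi_fixpoint_pos]. }
split; [|split].
- intros n; split.
  + destruct (Horb (2 * n + 1)%nat) as [He _].
    rewrite pow_m1_odd in He.
    replace (2 * (2 * n + 1) + 2)%nat with (4 * n + 4)%nat in He by lia; lra.
  + destruct (Horb (2 * n + 2)%nat) as [He _].
    rewrite pow_m1_even in He.
    replace (2 * (2 * n + 2) + 2)%nat with (4 * n + 6)%nat in He by lia; lra.
- apply is_lim_seq_ext with
    (fun n => - ((-1) ^ (2 * n + 1) * x (2 * (2 * n + 1) + 1)%nat)).
  { intros n; rewrite pow_m1_odd.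
    replace (2 * (2 * n + 1) + 1)%nat with (4 * n + 3)%nat by lia; ring. }
  replace (Finite (- 249 * (sqrt 5 - 2)))
    with (Rbar_opp (249 * (sqrt 5 - 2))) by (simpl; f_equal; ring).
  apply -> is_lim_seq_opp.
  apply (is_lim_seq_subseq _ _ (fun n => (2 * n + 1)%nat)) with (2 := Hlim).
  apply eventually_subseq; intros n; lia.
- apply is_lim_seq_ext with
    (fun n => (-1) ^ (2 * n + 2) * x (2 * (2 * n + 2) + 1)%nat).
  { intros n; rewrite pow_m1_even.
    replace (2 * (2 * n + 2) + 1)%nat with (4 * n + 5)%nat by lia; ring. }
  apply (is_lim_seq_subseq _ _ (fun n => (2 * n + 2)%nat)) with (2 := Hlim).
  apply eventually_subseq; intros n; lia.
Qed.
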